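(* Let $n\geq 3$, let $S^1$ be the unit circle centered at the origin in $\mathbb{R}^2$, let $K_n$ be a regular $n$-gon inscribed in $S^1$, and let $V$ be the vertex set of $K_n$. Let $x$ be a point sufficiently close to the center of $S^1$ (i.e., within distance $\varepsilon$ of the origin for a suitably small $\varepsilon>0$ depending on $n$) which is in general position with respect to $V$ (i.e., $x$ lies on no line through two points of $V$). Then the maximum size of an intersecting family of triangles spanned by $V$ is equal to the number of triangles spanned by $V$ that contain $x$ in their interior.
   Context: A triangle is spanned by a point set $P$ if its three vertices belong to $P$. Two triangles are intersecting if their interiors intersect, and a family of triangles is intersecting if every two of its members are intersecting. *)

(* Defs.v *)
From HB Require Import structures.
From mathcomp Require Import all_boot all_order all_algebra.
From mathcomp Require Import all_classical all_reals all_analysis.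
Set Implicit Arguments.
Unset Strict Implicit.
Unset Printing Implicit Defensive.
Import Order.TTheory GRing.Theory Num.Theory.
Import numFieldNormedType.Exports.
Local Open Scope classical_set_scope.
Local Open Scope card_scope.
Local Open Scope ring_scope.

Notation plane R := 'rV[R]_2.

(* The library norm on matrices is the sup norm, hence this definition. *)
Definition euclidean_norm (R : realType) (p : plane R) : R :=
  Num.sqrt (\sum_(i < 2) p ord0 i ^+ 2).

Definition circle_point (R : realType) (t : R) : plane R :=
  \row_(i < 2) (if i == ord0 then cos t else sin t).

(* The angle [t] is the free rotation of the polygon about the origin. *)
Definition regular_gon_vertices (R : realType) (n : nat) (V : set (plane R)) :
    Prop :=
  exists t : R,
    V = range (fun k : 'I_n => circle_point (t + 2 * pi * k%:R / n%:R)).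

(* A line only when [a != b]; this is required wherever it is used. *)
Definition line (R : realType) (a b : plane R) : set (plane R) :=
  [set p | exists s : R, p = (1 - s) *: a + s *: b].

Definition general_position (R : realType) (V : set (plane R)) (x : plane R) :
    Prop :=
  forall a b, V a -> V b -> a != b -> ~ line a b x.

Definition hull3 (R : realType) (a b c : plane R) : set (plane R) :=
  [set p | exists r s t : R,
     [/\ 0 <= r, 0 <= s, 0 <= t, r + s + t = 1 &
         p = r *: a + s *: b + t *: c]].

(* Triangles are nondegenerate closed regions of the plane. Such a region
   determines its three vertices, so families of triangles can be counted as
   sets of regions. *)
Definition spanned_triangle (R : realType) (P : set (plane R))
    (T : set (plane R)) : Prop :=
  exists a b c, [/\ P a, P b & P c] /\
    [/\ a != b, ~ line a b c & T = hull3 a b c].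

Definition intersecting (R : realType) (S T : set (plane R)) : Prop :=
  interior S `&` interior T !=set0.

Definition intersecting_family (R : realType) (F : set (set (plane R))) : Prop :=
  forall S T, F S -> F T -> S <> T -> intersecting S T.

Definition max_intersecting_size (R : realType) (P : set (plane R)) (m : nat) :
    Prop :=
  (exists F : set (set (plane R)),
     [/\ F `<=` spanned_triangle P, intersecting_family F & F #= `I_m]) /\
  (forall F : set (set (plane R)),
     F `<=` spanned_triangle P -> intersecting_family F -> F #<= `I_m).

(* Main.v *)
Require Import Defs.
From HB Require Import structures.
From mathcomp Require Import all_boot all_order all_algebra.
From mathcomp Require Import all_classical all_reals all_analysis.
From mathcomp Require Import zify ring lra.
Import Order.TTheory GRing.Theory Num.Theory.
Import numFieldNormedType.Exports.
Local Open Scope classical_set_scope.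
Local Open Scope card_scope.
Local Open Scope ring_scope.

(* The triangles containing x form an intersecting family, so it suffices to
   inject an arbitrary intersecting family F into them.  Number the vertices
   cyclically.  A triangle abc of F that misses x is cut off from x by one of
   its sides, say ac, and the arc from a to c through b is at most a half
   circle.  Replace b by the (nearly) antipodal vertex b + floor(n/2); the
   resulting triangle contains x.  Triangles containing x are kept.  If two
   distinct triangles have the same image Q, each of them is either Q or lies
   beyond a side of Q, and for distinct originals these sides are distinct
   because b is recovered from ac and Q.  A side of Q then separates the two
   originals, so they do not intersect. *)

(** * Orientation of point triples and separation of triangles *)

(** Twice the signed area of [abc], positive for a counterclockwise turn. *)
Definition orient {R : realType} (a b c : plane R) : R :=
  (b ord0 ord0 - a ord0 ord0) * (c ord0 ord_max - a ord0 ord_max)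
  - (b ord0 ord_max - a ord0 ord_max) * (c ord0 ord0 - a ord0 ord0).

Lemma plane_eq {R : realType} (p q : plane R) :
  p ord0 ord0 = q ord0 ord0 -> p ord0 ord_max = q ord0 ord_max -> p = q.
Proof.
move=> h0 h1; apply/rowP => i; case: (unliftP ord0 i) => [j|] ->.
  by rewrite (_ : lift ord0 j = ord_max) //; apply: val_inj; case: j => -[].
exact: h0.
Qed.

Lemma sqdist_gt0 {R : realType} (p q : plane R) : p != q ->
  0 < (q ord0 ord0 - p ord0 ord0) ^+ 2 + (q ord0 ord_max - p ord0 ord_max) ^+ 2.
Proof.
move=> pq; rewrite lt_neqAle addr_ge0 ?sqr_ge0 // andbT eq_sym.
apply: contra pq; rewrite paddr_eq0 ?sqr_ge0 // !sqrf_eq0 !subr_eq0.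
by move=> /andP[/eqP e0 /eqP e1]; apply/eqP/plane_eq.
Qed.

Lemma orientC {R : realType} (a b c : plane R) : orient a b c = orient b c a.
Proof. by rewrite /orient; ring. Qed.

Lemma orientN {R : realType} (a b c : plane R) : orient a c b = - orient a b c.
Proof. by rewrite /orient; ring. Qed.

Lemma orient_swap {R : realType} (a b c : plane R) : orient b a c = - orient a b c.
Proof. by rewrite /orient; ring. Qed.

Lemma orient_same {R : realType} (a b : plane R) : orient a b a = 0.
Proof. by rewrite /orient; ring. Qed.

Lemma hull3C {R : realType} (a b c : plane R) : hull3 a b c = hull3 b c a.
Proof.
apply/seteqP; split=> p [r [s [t [r0 s0 t0 rst ->]]]].
  by exists s, t, r; split=> //; [lra | rewrite -addrA addrC].
by exists t, r, s; split=> //; [lra | rewrite addrC addrA].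
Qed.

Lemma hull3_swap {R : realType} (a b c : plane R) : hull3 a b c = hull3 a c b.
Proof.
by apply/seteqP; split=> p [r [s [t [r0 s0 t0 rst ->]]]];
  exists r, t, s; split=> //; [lra | rewrite addrAC | lra | rewrite addrAC].
Qed.

Lemma orient_eq0_line {R : realType} (a b c : plane R) :
  a != b -> orient a b c = 0 <-> line a b c.
Proof.
move=> ab; split; last first.
  by move=> [s ->]; rewrite /orient !mxE; ring.
rewrite /orient => h.
set u0 := b ord0 ord0 - a ord0 ord0 in h.
set u1 := b ord0 ord_max - a ord0 ord_max in h.
have D0 : u0 ^+ 2 + u1 ^+ 2 != 0 by rewrite gt_eqF // sqdist_gt0.
set v0 := c ord0 ord0 - a ord0 ord0 in h.
set v1 := c ord0 ord_max - a ord0 ord_max in h.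
have e : u0 * v1 = u1 * v0 by apply/eqP; rewrite -subr_eq0 h.
(* The parameter of the orthogonal projection of [c] onto the line [ab]; by [e] the projection is
   [c] itself. *)
exists ((u0 * v0 + u1 * v1) / (u0 ^+ 2 + u1 ^+ 2)).
apply: plane_eq; rewrite !mxE.
- transitivity (a ord0 ord0 + (u0 * v0 + u1 * v1) / (u0 ^+ 2 + u1 ^+ 2) * u0);
    last by rewrite /u0; ring.
  have -> : (u0 * v0 + u1 * v1) / (u0 ^+ 2 + u1 ^+ 2) * u0 =
    (u0 ^+ 2 * v0 + u1 * (u0 * v1)) / (u0 ^+ 2 + u1 ^+ 2) by field.
  rewrite e (_ : _ / _ = v0); last by field.
  by rewrite /v0; ring.
- transitivity (a ord0 ord_max + (u0 * v0 + u1 * v1) / (u0 ^+ 2 + u1 ^+ 2) * u1);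
    last by rewrite /u1; ring.
  have -> : (u0 * v0 + u1 * v1) / (u0 ^+ 2 + u1 ^+ 2) * u1 =
    (u1 ^+ 2 * v1 + u0 * (u1 * v0)) / (u0 ^+ 2 + u1 ^+ 2) by field.
  rewrite -e (_ : _ / _ = v1); last by field.
  by rewrite /v1; ring.
Qed.

Lemma orient_neq {R : realType} (a b c : plane R) : orient a b c != 0 -> a != b.
Proof. by apply: contraNneq => ->; rewrite /orient; apply/eqP; ring. Qed.

Lemma affine_continuous {R : realType} (c d e : R) :
  continuous (fun y : plane R => c * y ord0 ord0 + d * y ord0 ord_max + e).
Proof.
have gen (F : set_system (plane R)) (FF : Filter F) (u v : R) :
    (fun y : plane R => y ord0 ord0) z @[z --> F] --> u ->
    (fun y : plane R => y ord0 ord_max) z @[z --> F] --> v ->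
    c * z ord0 ord0 + d * z ord0 ord_max + e @[z --> F] --> c * u + d * v + e.
  by move=> hu hv; apply: cvgD; last (exact: cvg_cst); apply: cvgD;
    apply: cvgMl_tmp.
move=> y; have C i j : (fun y : plane R => y i j) z @[z --> y] --> y i j.
  exact: coord_continuous.
exact: (gen _ (nbhs_filter y) _ _ (C _ _) (C _ _)).
Qed.

(** The three inequalities are open conditions, and a point [y] satisfying them has positive
    barycentric coordinates: the areas of the subtriangles at [y] divided by that of [abc]. *)
Lemma orient_gt0_interior {R : realType} (a b c x : plane R) :
  0 < orient a b x -> 0 < orient b c x -> 0 < orient c a x ->
  interior (hull3 a b c) x.
Proof.
have O p q : continuous (fun y : plane R => orient p q y).
  have -> : (fun y : plane R => orient p q y) = (fun y : plane R =>
      (p ord0 ord_max - q ord0 ord_max) * y ord0 ord0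
      + (q ord0 ord0 - p ord0 ord0) * y ord0 ord_max
      + (p ord0 ord0 * q ord0 ord_max - p ord0 ord_max * q ord0 ord0)).
    by apply/funext => y; rewrite /orient; ring.
  exact: affine_continuous.
move=> h1 h2 h3; change (nbhs x (hull3 a b c)).
have FF := nbhs_filter x.
have n1 := @cvgr_gt R _ _ FF _ _ (O a b x) _ h1.
have n2 := @cvgr_gt R _ _ FF _ _ (O b c x) _ h2.
have n3 := @cvgr_gt R _ _ FF _ _ (O c a x) _ h3.
apply: (@filterS _ _ FF _ _ _ (@filterI _ _ FF _ _ n1 (@filterI _ _ FF _ _ n2 n3))).
move=> y /= [g3 [g1 g2]].
set D := orient a b c.
have DE : D = orient b c y + orient c a y + orient a b y.
  by rewrite /D /orient; ring.
have D0 : 0 < D by rewrite DE; lra.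
have Dn : D != 0 by rewrite gt_eqF.
have M (u v : R) : u / D * v * D = u * v by field.
exists (orient b c y / D), (orient c a y / D), (orient a b y / D).
split; try by apply: ltW; rewrite divr_gt0.
  by rewrite -!mulrDl -DE divff.
apply: plane_eq; rewrite !mxE; apply: (mulIf Dn); rewrite !mulrDl.
  by rewrite !M /D /orient; ring.
by rewrite !M /D /orient; ring.
Qed.

Lemma orient_hull3 {R : realType} (p q a b c y : plane R) :
  0 <= orient p q a -> 0 <= orient p q b -> 0 <= orient p q c ->
  hull3 a b c y -> 0 <= orient p q y.
Proof.
move=> ha hb hc [r [s [t [r0 s0 t0 rst ->]]]].
have -> : orient p q (r *: a + s *: b + t *: c) =
    r * orient p q a + s * orient p q b + t * orient p q c.
  have -> : r = 1 - s - t by lra.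
  by rewrite /orient !mxE; ring.
by rewrite !addr_ge0 ?mulr_ge0.
Qed.

(** From a common interior point, a small step along the normal [w] of [pq] stays in [S] but
    strictly increases [orient p q], which is already nonnegative there because the point lies in
    [T]. *)
Lemma separated_not_intersecting {R : realType} (p q : plane R) (S T : set (plane R)) :
  p != q -> (forall y, S y -> orient p q y <= 0) ->
  (forall y, T y -> 0 <= orient p q y) -> ~ intersecting S T.
Proof.
move=> pq hS hT [y [yS yT]].
set w : plane R := \row_i (if i == ord0 then - (q ord0 ord_max - p ord0 ord_max)
  else q ord0 ord0 - p ord0 ord0).
have /nbhs_ballP[e /= e0 He] : nbhs y (S `&` T) by exact: filterI.
(* [M] exceeds both coordinates of [w] in absolute value, so the step [(e / M) *: w] has sup norm
   below [e]. *)
set M := 1 + `|w ord0 ord0| + `|w ord0 ord_max|.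
have M0 : 0 < M by rewrite /M -addrA ltr_pwDl // addr_ge0.
have h0 : 0 < e / M by rewrite divr_gt0.
have [/hS hS' _] : (S `&` T) (y + (e / M) *: w).
  apply: He; split => // i j; rewrite !mxE /ball /= opprD addrA subrr sub0r normrN.
  rewrite normrM gtr0_norm // mulrAC ltr_pdivrMr // ltr_pM2l // ord1.
  have -> : (if j == ord0 then - (q ord0 ord_max - p ord0 ord_max)
    else q ord0 ord0 - p ord0 ord0) = w ord0 j by rewrite mxE.
  have [->|->] : j = ord0 \/ j = ord_max.
    by case: (unliftP ord0 j) => [k|] ->; [right; apply: val_inj; case: k => -[]|left].
    by rewrite /M addrAC ltrDr ltr_pwDl.
  by rewrite /M ltrDr ltr_pwDl.
have [_ /hT hT'] := He y (ballxx _ e0).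
have E : orient p q (y + (e / M) *: w) = orient p q y +
  (e / M) * ((q ord0 ord0 - p ord0 ord0) ^+ 2 +
             (q ord0 ord_max - p ord0 ord_max) ^+ 2).
  by rewrite /orient !mxE /=; ring.
have := sqdist_gt0 _ _ pq.
move: E hS' hT'; set A := _ + _ ^+ 2 => E hS' hT' A0.
have : 0 < e / M * A by rewrite mulr_gt0.
by lra.
Qed.

(** * Points of the unit circle and vertices of the regular polygon *)

(** Strict convexity of the disc: a unit vector [u] has inner product less than 1 with every other
    unit vector, so a convex combination of three others cannot have inner product 1 with [u]. *)
Lemma hull3_circle {R : realType} (a b c u : plane R) :
  (forall p, p \in [:: a; b; c; u] ->
     p ord0 ord0 ^+ 2 + p ord0 ord_max ^+ 2 = 1) ->
  hull3 a b c u -> u \in [:: a; b; c].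
Proof.
move=> h [r [s [t [r0 s0 t0 rst]]]] uE.
have L p : p \in [:: a; b; c; u] -> u != p ->
    u ord0 ord0 * p ord0 ord0 + u ord0 ord_max * p ord0 ord_max < 1.
  move=> /h hp up; have hu := h u; rewrite !inE eqxx !orbT in hu.
  have {}hu := hu isT.
  have := sqdist_gt0 _ _ up.
  by rewrite !sqrrB; lra.
apply/negPn/negP; rewrite !inE !negb_or => /and3P[ua ub uc].
have la := L a; rewrite !inE eqxx in la; have {}la := la isT ua.
have lb := L b; rewrite !inE eqxx !orbT in lb; have {}lb := lb isT ub.
have lc := L c; rewrite !inE eqxx !orbT in lc; have {}lc := lc isT uc.
have hu := h u; rewrite !inE eqxx !orbT in hu; have {hu L h} hu := hu isT.
have e0 := congr1 (fun p : plane R => u ord0 ord0 * p ord0 ord0) uE.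
have e1 := congr1 (fun p : plane R => u ord0 ord_max * p ord0 ord_max) uE.
rewrite !mxE /= in e0 e1.
move: la lb lc; set A := (X in X < 1) => la; set B := (X in X < 1) => lb.
set C := (X in X < 1) => lc.
have E : r * A + s * B + t * C = 1.
  by rewrite -hu !expr2 {1}e0 {1}e1 /A /B /C; ring.
have : 0 < r * (1 - A) + s * (1 - B) + t * (1 - C).
  have [r1|] := ltP 0 r.
    have := mulr_gt0 r1 (_ : 0 < 1 - A); have := mulr_ge0 s0 (_ : 0 <= 1 - B).
    have := mulr_ge0 t0 (_ : 0 <= 1 - C); nra.
  have [s1|] := ltP 0 s; first nra.
  have [t1|] := ltP 0 t; first nra.
  lra.
by nra.
Qed.

(** Measuring the arcs as [u *+ 2] and [v *+ 2] turns the area into a product of sines of half arcs,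
    whose sign can be read off. *)
Lemma orient_circle {R : realType} (a u v : R) :
  orient (circle_point a) (circle_point (a + u *+ 2))
    (circle_point (a + u *+ 2 + v *+ 2)) = 4 * (sin u * sin v * sin (u + v)).
Proof.
set b := a + u *+ 2; set c := b + v *+ 2.
have -> : orient (circle_point a) (circle_point b) (circle_point c) =
    sin (b - a) + sin (c - b) - sin (c - a).
  by rewrite /orient !mxE /= !sinB; ring.
have -> : b - a = u *+ 2 by rewrite /b; ring.
have -> : c - b = v *+ 2 by rewrite /c; ring.
have -> : c - a = u *+ 2 + v *+ 2 by rewrite /c /b; ring.
rewrite (sinD (u *+ 2) (v *+ 2)) !sin_mulr2n !cos_mulr2n (sinD u v).
have S (w : R) : 1 - cos w ^+ 2 = sin w ^+ 2 by rewrite -(cos2Dsin2 w); ring.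
transitivity (2 * (sin u * cos u * (1 - cos v ^+ 2) +
                   sin v * cos v * (1 - cos u ^+ 2)) *+ 2); first by ring.
by rewrite !S; ring.
Qed.

(* Integer rather than ordinal indices: every cyclic arc is lifted to an
   interval, so arguments about cyclic order become linear arithmetic. *)
Definition gon_point {R : realType} (t : R) (n : nat) (k : int) : plane R :=
  circle_point (t + 2 * pi * k%:~R / n%:R).

Lemma gon_point_norm {R : realType} (t : R) n k (p := gon_point t n k) :
  p ord0 ord0 ^+ 2 + p ord0 ord_max ^+ 2 = 1.
Proof. by rewrite !mxE /= cos2Dsin2. Qed.

Lemma gon_pointDn {R : realType} (t : R) n (k q : int) : (0 < n)%N ->
  gon_point t n (k + q * n%:Z) = gon_point t n k.
Proof.
move=> n0; have nR : n%:R != 0 :> R by rewrite pnatr_eq0 -lt0n.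
have S j : gon_point t n (j + n%:Z) = gon_point t n j.
  rewrite /gon_point; have -> : t + 2 * pi * (j + n%:Z)%:~R / n%:R =
      t + 2 * pi * j%:~R / n%:R + pi *+ 2.
    by rewrite intrD -[n%:Z%:~R]/(n%:R); field.
  by apply: plane_eq; rewrite !mxE /= ?cosD2pi ?sinD2pi.
elim/int_rec: q => [|q IH|q IH]; first by rewrite mul0r addr0.
  by rewrite -[in RHS]IH -[in RHS]S; congr gon_point; lia.
by rewrite -[in LHS]S -[in RHS]IH; congr gon_point; lia.
Qed.

(** The half arcs are multiples [pi * l / n] with [0 < l < n], so all three sines in [orient_circle]
    are positive. *)
Lemma orient_gon_gt0 {R : realType} (t : R) (n : nat) (i j k : int) :
  i < j -> j < k -> k < i + n%:Z ->
  0 < orient (gon_point t n i) (gon_point t n j) (gon_point t n k).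
Proof.
move=> ij jk kn; have n0 : 0 < n%:R :> R by rewrite ltr0n; lia.
have nR : n%:R != 0 :> R by rewrite gt_eqF.
have S (l : int) : 0 < l -> l < n%:Z -> 0 < sin (pi * l%:~R / n%:R : R).
  move=> l0 ln; apply: sin_gt0_pi.
  rewrite divr_gt0 ?mulr_gt0 ?pi_gt0 ?ltr0z //= ltr_pdivrMr //.
  by rewrite ltr_pM2l ?pi_gt0 // -[n%:R]/(n%:Z%:~R) ltr_int.
have E (l m : int) : t + 2 * pi * l%:~R / n%:R =
    t + 2 * pi * m%:~R / n%:R + (pi * (l - m)%:~R / n%:R) *+ 2.
  by rewrite intrB; field.
rewrite /gon_point (E k j) (E j i) orient_circle -mulrDl -mulrDr -intrD.
by rewrite !mulr_gt0 ?ltr0n //; apply: S; lia.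
Qed.

Lemma gon_point_neq {R : realType} (t : R) (n : nat) (i j : int) : (3 <= n)%N ->
  i < j -> j < i + n%:Z -> gon_point t n i != gon_point t n j.
Proof.
move=> n3 ij jn; have [jn'|jn'] := ltP (j + 1) (i + n%:Z).
  by apply: (orient_neq _ _ (gon_point t n (j + 1)));
    rewrite gt_eqF // orient_gon_gt0; lia.
apply: (orient_neq _ _ (gon_point t n (i + 1))).
by rewrite orientN oppr_eq0 gt_eqF // orient_gon_gt0; lia.
Qed.

Lemma gon_point_inj {R : realType} (t : R) (n : nat) (i j : int) : (3 <= n)%N ->
  gon_point t n i = gon_point t n j -> exists q : int, j = i + q * n%:Z.
Proof.
move=> n3 e; have n0 : (0 < n)%N by lia.
exists ((j - i) %/ n%:Z)%Z.
have D := divz_eq (j - i) n%:Z.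
have r0 := modz_ge0 (j - i) (_ : n%:Z != 0); have rn := ltz_pmod (j - i) (_ : 0 < n%:Z).
have {}r0 := r0 ltac:(lia); have {}rn := rn ltac:(lia).
set q := (_ %/ _)%Z in D *; set r := (_ %% _)%Z in D r0 rn.
have [r1|r1] := ltP 0 r; last by lia.
have := gon_point_neq t n i (i + r) n3 ltac:(lia) ltac:(lia).
rewrite e; have -> : j = i + r + q * n%:Z by lia.
by rewrite gon_pointDn // eqxx.
Qed.

Lemma gon_point_eq {R : realType} (t : R) (n : nat) (i j : int) : (3 <= n)%N ->
  gon_point t n i = gon_point t n j -> i - n%:Z < j -> j < i + n%:Z -> i = j.
Proof.
move=> n3 e h1 h2; case: (ltgtP i j) => // ij.
  by have := gon_point_neq t n i j n3 ij h2; rewrite e eqxx.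
by have := gon_point_neq t n j i n3 ij ltac:(lia); rewrite e eqxx.
Qed.

(** * Triangles of the polygon as cyclically ordered index triples *)

Definition gon_triangle {R : realType} (t : R) (n : nat) (a b c : int) :=
  hull3 (gon_point t n a) (gon_point t n b) (gon_point t n c).

(** Counterclockwise order lifted to one window of length [n]; renaming the first vertex moves [a]
    to [a + n]. *)
Definition cyclic_lt (n : nat) (a b c : int) :=
  [/\ a < b, b < c & c < a + n%:Z].

Lemma gon_triangle_shift {R : realType} (t : R) n (a b c q : int) : (0 < n)%N ->
  gon_triangle t n (a + q * n%:Z) (b + q * n%:Z) (c + q * n%:Z) =
  gon_triangle t n a b c.
Proof. by move=> n0; rewrite /gon_triangle !gon_pointDn. Qed.

Lemma gon_triangle_rot {R : realType} (t : R) n (a b c : int) : (0 < n)%N ->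
  gon_triangle t n b c (a + n%:Z) = gon_triangle t n a b c.
Proof.
move=> n0; have := gon_pointDn t n a 1 n0; rewrite mul1r /gon_triangle => ->.
by rewrite -hull3C.
Qed.

(** By [hull3_circle] each vertex of one triangle is a vertex of the other. The shared first index
    puts all indices in one window, where equal points have equal indices. *)
Lemma gon_triangle_eq_base {R : realType} (t : R) n (a c d c' d' : int) :
  (3 <= n)%N -> cyclic_lt n a c d -> cyclic_lt n a c' d' ->
  gon_triangle t n a c d = gon_triangle t n a c' d' -> c = c' /\ d = d'.
Proof.
move=> n3 [ac cd da] [ac' cd' da'] e.
have V u : u \in [:: a; c; d] -> exists2 v, v \in [:: a; c'; d'] &
    gon_point t n u = gon_point t n v.
  move=> uT.
  have : gon_triangle t n a c' d' (gon_point t n u).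
    rewrite -e /gon_triangle; move: uT; rewrite !inE => /or3P[]/eqP->.
    - by exists 1, 0, 0; split => //; rewrite ?addr0 // scale1r !scale0r !addr0.
    - by exists 0, 1, 0; split => //; rewrite ?addr0 ?add0r // scale1r !scale0r addr0 add0r.
    - by exists 0, 0, 1; split => //; rewrite ?addr0 ?add0r // scale1r !scale0r !add0r.
  move/hull3_circle => H; have {H} := H _; rewrite !inE => H.
  have /or3P[/eqP->|/eqP->|/eqP->] : [|| gon_point t n u == gon_point t n a,
      gon_point t n u == gon_point t n c' | gon_point t n u == gon_point t n d'].
    by apply: H => p; rewrite !inE => /or4P[]/eqP->; exact: gon_point_norm.
  - by exists a; rewrite // !inE eqxx.
  - by exists c'; rewrite // !inE eqxx ?orbT.
  - by exists d'; rewrite // !inE eqxx ?orbT.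
have I u v : u < v + n%:Z -> v < u + n%:Z -> gon_point t n u = gon_point t n v -> u = v.
  by move=> h1 h2 h; apply: (gon_point_eq t n u v n3 h); lia.
have [|v vT cv] := V c; first by rewrite !inE eqxx orbT.
have [|w wT dw] := V d; first by rewrite !inE eqxx !orbT.
have {cv} cv : c = v.
  by apply: I cv; move: vT; rewrite !inE => /or3P[]/eqP->; lia.
have {dw} dw : d = w.
  by apply: I dw; move: wT; rewrite !inE => /or3P[]/eqP->; lia.
by move: vT wT; rewrite !inE => /or3P[]/eqP ? /or3P[]/eqP ?; lia.
Qed.

(** The vertex [a] is one of the three primed vertices; rotating the primed labels to start there
    reduces to [gon_triangle_eq_base]. The cases are the three rotations, and [q] counts full
    turns. *)
Lemma gon_triangle_eq {R : realType} (t : R) n (a c d a' c' d' : int) :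
  (3 <= n)%N -> cyclic_lt n a c d -> cyclic_lt n a' c' d' ->
  gon_triangle t n a c d = gon_triangle t n a' c' d' ->
  exists q : int, let s u := u + q * n%:Z in
  [\/ [/\ a = s a', c = s c' & d = s d'],
      [/\ a = s c', c = s d' & d = s a' + n%:Z] |
      [/\ a = s d', c = s a' + n%:Z & d = s c' + n%:Z]].
Proof.
move=> n3 h h' e; have n0 : (0 < n)%N by lia.
have B a1 c1 d1 : cyclic_lt n a1 c1 d1 ->
    gon_triangle t n a1 c1 d1 = gon_triangle t n a' c' d' ->
    gon_point t n a = gon_point t n a1 ->
    exists q : int, [/\ a = a1 + q * n%:Z, c = c1 + q * n%:Z & d = d1 + q * n%:Z].
  move=> h1 e1 /esym/(gon_point_inj _ _ _ _ n3)[q qE]; exists q.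
  case: (gon_triangle_eq_base t n a c d (c1 + q * n%:Z) (d1 + q * n%:Z)) => //.
    by move: h1; rewrite qE => -[? ? ?]; split; lia.
  by rewrite e -e1 qE gon_triangle_shift.
have : gon_triangle t n a' c' d' (gon_point t n a).
  rewrite -e; exists 1, 0, 0; split => //; first by rewrite !addr0.
  by rewrite scale1r !scale0r !addr0.
case: h' (h') => h1 h2 h3 h' /hull3_circle H.
have /H : forall p, p \in [:: gon_point t n a'; gon_point t n c';
     gon_point t n d'; gon_point t n a] ->
     p ord0 ord0 ^+ 2 + p ord0 ord_max ^+ 2 = 1.
  by move=> p; rewrite !inE => /or4P[]/eqP->; exact: gon_point_norm.
rewrite !inE => /or3P[]/eqP pa.
- by have [q [? ? ?]] := B a' c' d' h' erefl pa; exists q; apply: Or31; split.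
- have [||q [? ? ?]] := B c' d' (a' + n%:Z) _ _ pa; first by split; lia.
    by rewrite gon_triangle_rot.
  by exists q; apply: Or32; split=> //; lia.
- have [||q [? ? ?]] := B d' (a' + n%:Z) (c' + n%:Z) _ _ pa; first by split; lia.
    by rewrite !gon_triangle_rot.
  by exists q; apply: Or33; split=> //; lia.
Qed.

(** * Separation by a chord, and flips across a side *)

(** The chord [ij] separates the two arcs. The inequalities are weak so that both triangles may use
    its endpoints. *)
Lemma gon_triangle_separated {R : realType} (t : R) n (i j a b c a' b' c' : int) :
  (3 <= n)%N -> i < j -> j < i + n%:Z ->
  [&& i <= a <= j, i <= b <= j & i <= c <= j] ->
  [&& j <= a' <= i + n%:Z, j <= b' <= i + n%:Z & j <= c' <= i + n%:Z] ->
  ~ intersecting (gon_triangle t n a b c) (gon_triangle t n a' b' c').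
Proof.
move=> n3 ij jn /and3P[ha hb hc] /and3P[ha' hb' hc'].
have n0 : (0 < n)%N by lia.
have L k : i <= k <= j -> 0 <= orient (gon_point t n j) (gon_point t n i) (gon_point t n k).
  move=> /andP[]; rewrite le_eqVlt => /predU1P[-> _|ik].
    by rewrite 2!orientC orient_same.
  rewrite le_eqVlt => /predU1P[->|kj]; first by rewrite orient_same.
  by rewrite orientC ltW // orient_gon_gt0 //; lia.
have G k : j <= k <= i + n%:Z -> 0 <= orient (gon_point t n i) (gon_point t n j) (gon_point t n k).
  move=> /andP[]; rewrite le_eqVlt => /predU1P[-> _|jk].
    by rewrite 2!orientC orient_same.
  rewrite le_eqVlt => /predU1P[->|kj].
    by have := gon_pointDn t n i 1 n0; rewrite mul1r => ->; rewrite orient_same.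
  by rewrite ltW // orient_gon_gt0.
apply: (separated_not_intersecting (gon_point t n i) (gon_point t n j)).
- exact: gon_point_neq.
- move=> y yT; rewrite orient_swap oppr_le0.
  by apply: orient_hull3 yT; exact: L.
- by move=> y yT; apply: orient_hull3 yT; exact: G.
Qed.

Lemma intersecting_sym {R : realType} (S T : set (plane R)) :
  intersecting S T -> intersecting T S.
Proof. by rewrite /intersecting setIC. Qed.

Lemma flip_disjoint {R : realType} (t : R) n (a b c d : int) :
  (3 <= n)%N -> cyclic_lt n a b c -> cyclic_lt n a c d ->
  ~ intersecting (gon_triangle t n a b c) (gon_triangle t n a c d).
Proof.
move=> n3 [h1 h2 h3] [h4 h5 h6].
rewrite -(gon_triangle_rot t n a c d); last by lia.
by apply: (gon_triangle_separated t n a c) => //; lia.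
Qed.

Lemma flip_inj {R : realType} (t : R) n (m a b c a' b' c' : int) :
  (3 <= n)%N -> cyclic_lt n a b c -> cyclic_lt n a' b' c' ->
  cyclic_lt n a c (b + m) -> cyclic_lt n a' c' (b' + m) ->
  gon_triangle t n a c (b + m) = gon_triangle t n a' c' (b' + m) ->
  intersecting (gon_triangle t n a b c) (gon_triangle t n a' b' c') ->
  gon_triangle t n a b c = gon_triangle t n a' b' c'.
Proof.
move=> n3 h h' hQ hQ' e TT'; have n0 : (0 < n)%N by lia.
have [q /= H] := gon_triangle_eq t n _ _ _ _ _ _ n3 hQ hQ' e.
case: h h' hQ hQ' => ? ? ? [? ? ?] [? ? ?] [? ? ?].
case: H => -[ea ec ed].
(* With matching labels the same side was flipped, and subtracting [m] from the third vertex
   recovers the original one. *)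
- have -> : b = b' + q * n%:Z by lia.
  by rewrite ea ec gon_triangle_shift.
(* With rotated labels the originals lie beyond different sides of the common image. After [q + 1]
   turns the second one lies on the arc from [c] to [a + n], so the chord [ac] separates them; the
   last case is alike. *)
- case: (gon_triangle_separated t n a c a b c (a' + (q + 1) * n%:Z)
    (b' + (q + 1) * n%:Z) (c' + (q + 1) * n%:Z)) => //; try lia.
  by rewrite gon_triangle_shift.
- case: (gon_triangle_separated t n a c a b c (a' + (q + 1) * n%:Z)
    (b' + (q + 1) * n%:Z) (c' + (q + 1) * n%:Z)) => //; try lia.
  by rewrite gon_triangle_shift.
Qed.

(** * Orientations seen from a point near the center *)

Lemma coord_le_norm {R : realType} (p : plane R) i :
  `|p ord0 i| <= euclidean_norm p.
Proof.
rewrite -sqrtr_sqr /euclidean_norm ler_sqrt; last first.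
  by apply: sumr_ge0 => k _; exact: sqr_ge0.
by rewrite (bigD1 i) //= lerDl; apply: sumr_ge0 => k _; exact: sqr_ge0.
Qed.

Lemma sin_lower_bound {R : realType} (n : nat) : exists2 delta : R, 0 < delta &
  forall k : nat, (0 < k)%N -> (k.*2 < n)%N -> delta <= sin (2 * pi * k%:R / n%:R).
Proof.
pose f k : R := sin (2 * pi * k%:R / n%:R).
(* The default 1 keeps the minimum positive even when no [k] qualifies. *)
exists (\big[Order.min/1]_(k < n | (0 < k)%N && (k.*2 < n)%N) f k).
  apply: lt_bigmin => // k /andP[k0 kn]; apply: sin_gt0_pi.
  have n0 : 0 < n%:R :> R by rewrite ltr0n; lia.
  apply/andP; split; first by rewrite divr_gt0 // mulr_gt0 ?ltr0n // mulr_gt0 ?pi_gt0.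
  by rewrite /= ltr_pdivrMr // (mulrC 2) -mulrA ltr_pM2l ?pi_gt0 // -natrM ltr_nat mul2n.
move=> k k0 kn; have kn' : (k < n)%N by lia.
by apply: (bigmin_le_cond _ (j := Ordinal kn') (fun i : 'I_n => f i)) => /=; rewrite k0.
Qed.

(** At the origin the orientation is the sine of the arc, at least [delta]. Moving to [x] adds two
    terms, each at most twice the norm of [x], hence [delta / 4]. Arcs of exactly half a circle are
    excluded, since there the sine vanishes. *)
Lemma near_center_orient {R : realType} (n : nat) : exists2 eps : R, 0 < eps &
  forall (t : R) (x : plane R) (i j : int), euclidean_norm x < eps ->
    i < j -> 2 * (j - i) < n%:Z -> 0 < orient (gon_point t n i) (gon_point t n j) x.
Proof.
have [delta d0 H] := sin_lower_bound (R := R) n.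
exists (delta / 4); first by rewrite divr_gt0.
move=> t x i j xe ij jn.
have n0 : n%:R != 0 :> R by rewrite pnatr_eq0; lia.
have := H `|j - i|%N ltac:(lia) ltac:(lia).
have -> : `|j - i|%N%:R = j%:~R - i%:~R :> R.
  by rewrite -[_%:R]/(_%:Z%:~R) gez0_abs; [rewrite intrB | lia].
have -> : 2 * pi * (j%:~R - i%:~R) / n%:R =
    (t + 2 * pi * j%:~R / n%:R) - (t + 2 * pi * i%:~R / n%:R) by field.
rewrite sinB /orient /gon_point !mxE /=.
set A := t + _; set B := t + _ => hs.
have := coord_le_norm x ord0; have := coord_le_norm x ord_max.
move: xe; set e := euclidean_norm x => xe; rewrite !ler_norml => /andP[h1 h2] /andP[h3 h4].
have : `|(cos A - cos B) * x ord0 ord_max| <= 2 * e.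
  rewrite normrM ler_pM // ?ler_norml ?h1 //.
  by have := cos_le1 A; have := cos_le1 B; have := cos_geN1 A; have := cos_geN1 B; lra.
have : `|(sin A - sin B) * x ord0 ord0| <= 2 * e.
  rewrite normrM ler_pM // ?ler_norml ?h3 //.
  by have := sin_le1 A; have := sin_le1 B; have := sin_geN1 A; have := sin_geN1 B; lra.
rewrite !ler_norml => /andP[h5 h6] /andP[h7 h8].
by lra.
Qed.

(** * From spanned triangles to index triples *)

Lemma gon_point_range {R : realType} (t : R) (n : nat) (k : int) : (0 < n)%N ->
  range (fun k : 'I_n => circle_point (t + 2 * pi * k%:R / n%:R)) (gon_point t n k).
Proof.
move=> n0; have rn := ltz_pmod k (_ : 0 < n%:Z); have {}rn := rn ltac:(lia).
have r0 := modz_ge0 k (_ : n%:Z != 0); have {}r0 := r0 ltac:(lia).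
have kn : (`|(k %% n%:Z)%Z| < n)%N by lia.
exists (Ordinal kn) => //=.
rewrite [in RHS](divz_eq k n%:Z) [X in gon_point _ _ X]addrC gon_pointDn // /gon_point.
by rewrite -[X in circle_point (_ + _ * X / _)]/(_%:Z%:~R) gez0_abs.
Qed.

Lemma spanned_triangle_gon {R : realType} (t : R) (n : nat)
    (T : set (plane R)) :
  (3 <= n)%N ->
  spanned_triangle (range (fun k : 'I_n => circle_point (t + 2 * pi * k%:R / n%:R))) T <->
  exists a b c, cyclic_lt n a b c /\ T = gon_triangle t n a b c.
Proof.
move=> n3; have n0 : (0 < n)%N by lia.
set V := (X in spanned_triangle X).
have VP k : V (gon_point t n k) by exact: gon_point_range.
split; last first.
  move=> [a [b [c [[ab bc ca] ->]]]].
  exists (gon_point t n a), (gon_point t n b), (gon_point t n c); split; first by split.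
  have o := orient_gon_gt0 t n a b c ab bc ca.
  have ne : gon_point t n a != gon_point t n b by apply: orient_neq; rewrite gt_eqF //; exact: o.
  by split=> //; move/(orient_eq0_line _ _ _ ne) => e; rewrite e ltxx in o.
move=> [pa [pb [pc [[[i _ <-] [j _ <-] [k _ <-]] [ab nl ->]]]]].
have E (l : 'I_n) : circle_point (t + 2 * pi * l%:R / n%:R) = gon_point t n l%:Z by [].
rewrite !E in ab nl *.
have ij : i <> j :> nat by move=> e; move: ab; rewrite e eqxx.
have ki : k <> i :> nat.
  by move=> e; apply: nl; rewrite e; apply/(orient_eq0_line _ _ _ ab); exact: orient_same.
have kj : k <> j :> nat.
  by move=> e; apply: nl; rewrite e; apply/(orient_eq0_line _ _ _ ab); rewrite 2!orientC orient_same.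
have := ltn_ord i; have := ltn_ord j; have := ltn_ord k.
move: (nat_of_ord i) (nat_of_ord j) (nat_of_ord k) ij ki kj => {ab nl} {}i {}j {}k ij ki kj kn jn in'.
(* The indices can be sorted because [hull3] is symmetric in its vertices. *)
wlog ijk : i j k ij ki kj kn jn in' / (i < j < k)%N.
  move=> W.
  have [?|h1] := boolP (i < j < k)%N; first exact: W.
  have [?|h2] := boolP (j < k < i)%N; first by rewrite hull3C; apply: W; lia.
  have [?|h3] := boolP (k < i < j)%N; first by rewrite 2!hull3C; apply: W; lia.
  have [?|h4] := boolP (i < k < j)%N; first by rewrite hull3_swap; apply: W; lia.
  have [?|h5] := boolP (j < i < k)%N; first by rewrite 2!hull3C hull3_swap hull3C; apply: W; lia.
  by rewrite hull3_swap hull3C; apply: W; lia.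
by exists i, j, k; split=> //; split; lia.
Qed.

(** * The flip onto [x] and the resulting injection *)

Lemma outside_flip {R : realType} (t : R) (n : nat) (a b c : int) (x : plane R) :
  (3 <= n)%N ->
  (forall i j : int, i < j -> 2 * (j - i) < n%:Z ->
     0 < orient (gon_point t n i) (gon_point t n j) x) ->
  (forall i j : int, gon_point t n i != gon_point t n j ->
     orient (gon_point t n i) (gon_point t n j) x != 0) ->
  cyclic_lt n a b c -> ~ interior (gon_triangle t n a b c) x ->
  exists a' b' c', [/\ cyclic_lt n a' b' c', cyclic_lt n a' c' (b' + n./2%:Z),
    gon_triangle t n a b c = gon_triangle t n a' b' c' &
    interior (gon_triangle t n a' c' (b' + n./2%:Z)) x].
Proof.
move=> n3 near gp h nI; have n0 : (0 < n)%N by lia.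
have Pn k : gon_point t n (k + n%:Z) = gon_point t n k.
  by have := gon_pointDn t n k 1 n0; rewrite mul1r.
(* Some side has [x] strictly on its outer side, as no orientation is zero and [x] is not interior;
   the labels are rotated to make it the side from [c'] to [a']. *)
have [a' [b' [c' [h' e o]]]] : exists a' b' c', [/\ cyclic_lt n a' b' c',
    gon_triangle t n a b c = gon_triangle t n a' b' c' &
    orient (gon_point t n c') (gon_point t n a') x < 0].
  have [h1 h2 h3] := h.
  have nab := gp _ _ (gon_point_neq t n a b n3 h1 ltac:(lia)).
  have nbc := gp _ _ (gon_point_neq t n b c n3 h2 ltac:(lia)).
  have nca : orient (gon_point t n c) (gon_point t n a) x != 0.
    by apply: gp; rewrite eq_sym; apply: gon_point_neq => //; lia.
  case: (ltgtP (orient (gon_point t n c) (gon_point t n a) x) 0) nca => // oca _.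
    by exists a, b, c.
  case: (ltgtP (orient (gon_point t n a) (gon_point t n b) x) 0) nab => // oab _.
    exists b, c, (a + n%:Z); split; first by split; lia.
      by rewrite gon_triangle_rot.
    by rewrite Pn.
  case: (ltgtP (orient (gon_point t n b) (gon_point t n c) x) 0) nbc => // obc _.
    exists c, (a + n%:Z), (b + n%:Z); split; first by split; lia.
      by rewrite !gon_triangle_rot.
    by rewrite Pn.
  by case: nI; apply: orient_gt0_interior.
have [h1 h2 h3] := h'.
(* Otherwise the complementary arc from [c'] to [a' + n] is shorter than half a circle, and [near]
   contradicts [o]. *)
have ca : 2 * (c' - a') <= n%:Z.
  rewrite leNgt; apply/negP => hca.
  have := near c' (a' + n%:Z) ltac:(lia) ltac:(lia).
  by rewrite Pn => /(lt_trans o); rewrite ltxx.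
exists a', b', c'; split => //; first by split; lia.
(* As [b'] lies strictly inside an arc of at most half a circle, the arcs from [c'] to [b' + n./2]
   and on to [a' + n] are both shorter than half, for either parity of [n]; [near] handles these
   sides and [o] the third. *)
apply: orient_gt0_interior.
- by rewrite orient_swap oppr_gt0.
- by apply: near; lia.
- by rewrite -(Pn a'); apply: near; lia.
Qed.

Theorem theorem1 (R : realType) (n : nat) (hn : (3 <= n)%N) :
  exists eps : R, 0 < eps /\
    forall (V : set (plane R)) (x : plane R),
      regular_gon_vertices n V ->
      euclidean_norm x < eps ->
      general_position V x ->
      exists m : nat,
        [set T | spanned_triangle V T /\ interior T x] #= `I_m /\
        max_intersecting_size V m.
Proof.
have [eps e0 near] := near_center_orient (R := R) n.
exists eps; split => // V x [t VE] xe gp.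
set S := [set T | _].
have spanV T : spanned_triangle V T <->
    exists a b c, cyclic_lt n a b c /\ T = gon_triangle t n a b c.
  by rewrite VE; exact: spanned_triangle_gon.
have gpP (i j : int) : gon_point t n i != gon_point t n j ->
    orient (gon_point t n i) (gon_point t n j) x != 0.
  move=> ij; apply/negP => /eqP /(orient_eq0_line _ _ _ ij).
  by apply: gp => //; rewrite VE; apply: gon_point_range; lia.
have finS : finite_set S.
  have finV : finite_set V by rewrite VE; exact: finite_image.
  apply: (@sub_finite_set _ _ ((fun p : plane R * plane R * plane R =>
    hull3 p.1.1 p.1.2 p.2) @` (V `*` V `*` V))).
    by move=> T [[a [b [c [[Va Vb Vc] [_ _ ->]]]]] _]; exists (a, b, c).
  by apply: finite_image; do !apply: finite_setX.
have [m Sm] := (finite_setP S).1 finS.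
exists m; split => //; split.
  exists S; split => //; first by move=> T [].
  by move=> T T' [_ hT] [_ hT'] _; exists x.
move=> F FV FI; rewrite -(card_le_eqr Sm).
(* The relation records how [Q] arises from [T], which the injectivity argument needs after
   choice. *)
pose G (T Q : set (plane R)) := S Q /\ (Q = T \/ exists a b c,
  [/\ cyclic_lt n a b c, cyclic_lt n a c (b + n./2%:Z),
   T = gon_triangle t n a b c & Q = gon_triangle t n a c (b + n./2%:Z)]).
have /choice[f fG] : forall T, exists Q, F T -> G T Q.
  move=> T; have [FT|FT] := pselect (F T); last by exists T.
  have [xT|xT] := pselect (interior T x).
    by exists T => _; split; [split => //; exact: FV | left].
  have [a [b [c [h TE]]]] := (spanV T).1 (FV _ FT).
  rewrite TE in xT.
  have [|a' [b' [c' [h1 h2 e xQ]]]] := outside_flip t n a b c x hn _ gpP h xT.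
    by move=> i j ij jn; exact: near.
  exists (gon_triangle t n a' c' (b' + n./2%:Z)) => _; split.
    by split => //; apply/spanV; exists a', c', (b' + n./2%:Z).
  by right; exists a', b', c'; rewrite TE.
have f_inj : {in F &, injective f}.
  move=> T T'; rewrite !inE => FT FT' ff.
  have [//|TT'] := pselect (T = T').
  have I := FI _ _ FT FT' TT'.
  have [_] := fG _ FT; have [_] := fG _ FT'; rewrite -ff.
  case=> [eQ'|[a' [b' [c' [h1' h2' eT' eQ']]]]].
    (* If one triangle is kept and the other flipped onto it, the flipped side separates them,
       against [I]. *)
    case=> [eQ|[a [b [c [h1 h2 eT eQ]]]]]; first by rewrite -eQ -eQ'.
    by case: (flip_disjoint t n a b c (b + n./2%:Z) hn h1 h2); rewrite -eT -eQ eQ'.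
  case=> [eQ|[a [b [c [h1 h2 eT eQ]]]]].
    case: (flip_disjoint t n a' b' c' (b' + n./2%:Z) hn h1' h2').
    by apply: intersecting_sym; rewrite -eT' -eQ' eQ.
  rewrite eT eT'; apply: (flip_inj t n n./2%:Z) => //; last by rewrite -eT -eT'.
  by rewrite -eQ -eQ'.
rewrite -(card_le_eql (inj_card_eq f_inj)); apply: subset_card_le.
by move=> _ [T FT <-]; have [] := fG _ FT.
Qed.
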